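(* For each positive integer $r$ there is a positive integer $k$ such that, with probability tending to $1$ as $n\to\infty$, the random hypergraph $\mathcal{H}=\mathcal{K}^{(r)}_n(k\text{-out})$ admits a perfect fractional matching, and the constant function $w\equiv 1/r$ is the only fractional cover of $\mathcal{H}$ of weight $n/r$.
   Context: An $r$-graph on a vertex set $V$ is a collection of $r$-element subsets (edges) of $V$. $\mathcal{K}^{(r)}_n$ denotes the complete $r$-graph on $V=[n]$ (all $r$-subsets are edges). The $k$-out model: for a host hypergraph $\mathcal{H}$ on $V$, the random subhypergraph $\mathcal{H}(k\text{-out})$ is $\bigcup_{v\in V}E_v$, where, for each $v$, $E_v$ is chosen uniformly at random from the $k$-element subsets of $\mathcal{H}_v=\{A\in\mathcal{H}: v\in A\}$ (or $E_v=\mathcal{H}_v$ if $|\mathcal{H}_v|<k$), these choices being made independently. A fractional cover of a hypergraph is a map $w:V\to[0,1]$ with $\sum_{v\in e}w(v)\ge 1$ for every edge $e$; its weight is $\sum_v w(v)$. A fractional matching is a map $\varphi$ from the edges to $[0,1]$ with $\sum_{e\ni v}\varphi(e)\le 1$ for all $v\in V$; its weight is $\sum_e\varphi(e)$. A fractional matching of an $r$-graph on $n$ vertices is perfect if its weight is $n/r$ (equivalently $\sum_{e\ni v}\varphi(e)=1$ for all $v$). *)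

(* Defs.v *)
From HB Require Import structures.
From mathcomp Require Import all_boot all_order all_algebra.
From mathcomp Require Import boolp classical_sets reals topology normedtype
  sequences.

Set Implicit Arguments.
Unset Strict Implicit.
Unset Printing Implicit Defensive.

Import Order.TTheory GRing.Theory Num.Theory.
Import numFieldNormedType.Exports.

Local Open Scope ring_scope.

Definition complete_hypergraph (T : finType) (r : nat) : {set {set T}} :=
  [set A : {set T} | #|A| == r].

Section FractionalCoversAndMatchings.
Context {R : realType} {T : finType}.
Implicit Types (H : {set {set T}}) (w : T -> R) (phi : {set T} -> R).

Definition fractional_cover H w : Prop :=
  (forall v, 0 <= w v <= 1) /\ (forall e, e \in H -> 1 <= \sum_(v in e) w v).

Definition cover_weight w : R := \sum_v w v.

(* Only the values of phi on the edges of H are meaningful: phi is a total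
   function, but its values at sets that are not edges are never used. *)
Definition fractional_matching H phi : Prop :=
  (forall e, e \in H -> 0 <= phi e <= 1) /\
  (forall v, \sum_(e in H | v \in e) phi e <= 1).

Definition matching_weight H phi : R := \sum_(e in H) phi e.

(* Meant for r-graphs H, i.e. when every edge of H has r elements. *)
Definition perfect_fractional_matching (r : nat) H phi : Prop :=
  fractional_matching H phi /\ matching_weight H phi = #|T|%:R / r%:R.

End FractionalCoversAndMatchings.

Section KOut.
Context {T : finType}.
Implicit Types (H : {set {set T}}) (v : T).

Definition star H v : {set {set T}} := [set A in H | v \in A].

(* The possible values of E_v. *)
Definition kout_choices (k : nat) H v : {set {set {set T}}} :=
  if (#|star H v| < k)%N then [set star H v]%SET
  else [set S : {set {set T}} | S \subset star H v & #|S| == k].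

Definition kout_union (E : {ffun T -> {set {set T}}}) : {set {set T}} :=
  (\bigcup_v E v)%SET.

End KOut.

Definition uniform_pmf (R : realType) (X : finType) (A : {set X}) (x : X) : R :=
  if x \in A then #|A|%:R^-1 else 0.

(* The probability that H(k-out) satisfies Q. As the E_v are independent, the
   law of the family (E_v)_v is the product of their uniform laws. *)
Definition kout_prob (R : realType) (T : finType) (k : nat) (H : {set {set T}})
    (Q : {set {set T}} -> Prop) : R :=
  \sum_(E : {ffun T -> {set {set T}}} | `[< Q (kout_union E) >])
    \prod_v uniform_pmf R (kout_choices k H v) (E v).

Lemma kout_choices_gt0 (T : finType) (k : nat) (H : {set {set T}}) (v : T) :
  (0 < #|kout_choices k H v|)%N.
Proof.
rewrite /kout_choices; case: (ltnP _ k) => [_|le_k]; first by rewrite cards1.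
by rewrite cards_draws bin_gt0.
Qed.

Lemma kout_prob_total (R : realType) (T : finType) (k : nat)
    (H : {set {set T}}) : kout_prob R k H (fun=> True) = 1.
Proof.
rewrite /kout_prob (eq_bigl xpredT); last by move=> E; exact/asboolP.
rewrite -(bigA_distr_bigA (fun v => uniform_pmf R (kout_choices k H v))) /=.
apply: big1 => v _; rewrite /uniform_pmf -big_mkcond /= sumr_const -[LHS]mulr_natl.
by rewrite divff // pnatr_eq0 -lt0n kout_choices_gt0.
Qed.

(* Main.v *)
(* Put x = w - 1/r. It suffices that, with high probability, x = 0 is the only
   x : V -> R with x(e) >= 0 on every edge and x(V) <= 0: this gives uniqueness
   of the cover directly, and a perfect fractional matching by Farkas' lemma.
   For a > 0 let A = {x <= -a} and B = {(r-1) x >= a}. Every edge chosen by a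
   vertex of A meets B, since otherwise its sum would be negative. If x <> 0 and
   x(V) <= 0, integrating over a gives some a with A nonempty and
   |B| <= (r-1)|A|. A union bound over all such disjoint pairs (A, B) shows that
   with high probability none has the property that all edges chosen in A
   meet B: a random edge at v in A meets B with probability at most c(r) < 1, and
   at most C(r)|A|/n, so that for k large the bound beats the number of pairs. *)
Require Import Defs.
From HB Require Import structures.
From mathcomp Require Import all_boot all_order all_algebra.
From mathcomp Require Import boolp classical_sets reals topology normedtype
  sequences.
From mathcomp Require Import exp ring lra zify.
Import Order.TTheory GRing.Theory Num.Theory.
Import numFieldNormedType.Exports.
Local Open Scope ring_scope.

(** * Layer-cake argument: expansion implies rigidity *)

(* Induction on the support of f: subtract from f and g the least positive value
   of f. *)
Lemma layer_cake_lt {R : realFieldType} {T : finType} (c : nat) (f g : T -> R) :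
  (forall v, 0 <= f v) -> (forall v, 0 <= g v) -> (exists v, f v != 0) ->
  (forall a, 0 < a -> (exists v, a <= f v) ->
     (c * #|[pred v | (a <= f v)%R]| < #|[pred v | (a <= g v)%R]|)%N) ->
  c%:R * \sum_v f v < \sum_v g v.
Proof.
elim: {f}_.+1 {-2}f (ltnSn #|[pred v | f v != 0]|) g => // d IHd f.
rewrite ltnS => fd g f0 g0 [v0 fv0] H.
have [v1 fv1 min_v1] := @arg_minP _ _ _ v0 (fun v => f v != 0) f fv0.
set m := f v1 in min_v1.
have m0 : 0 < m by rewrite lt_def fv1 f0.
pose f' v := Num.max (f v - m) 0; pose g' v := Num.max (g v - m) 0.
have sumf : \sum_v f v = m *+ #|[pred v | m <= f v]| + \sum_v f' v.
  rewrite -sumr_const [X in _ = X + _]big_mkcond -big_split /=; apply: eq_bigr => v _.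
  rewrite /f' inE; case: (leP m (f v)) => fvm.
    by rewrite max_l ?subr_ge0// addrC subrK.
  rewrite max_r ?subr_le0 ?ltW// addr0; apply/eqP/negPn/negP => fv.
  by have := min_v1 _ fv; rewrite leNgt fvm.
(* Only an inequality for [g], whose values may lie strictly between 0 and [m]. *)
have sumg : m *+ #|[pred v | m <= g v]| + \sum_v g' v <= \sum_v g v.
  rewrite -sumr_const [X in X + _]big_mkcond -big_split /=.
  apply: ler_sum => v _; rewrite /g' inE; case: (leP m (g v)) => gvm.
    by rewrite max_l ?subr_ge0// addrC subrK.
  by rewrite add0r max_r ?g0// subr_le0 ltW.
have Hm : c%:R * (m *+ #|[pred v | m <= f v]|) < m *+ #|[pred v | m <= g v]|.
  rewrite mulrnAr mulr_natl -mulrnA ltr_pMn2l//; apply: H => //.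
  by exists v1.
have shift (h : T -> R) a v : 0 < a -> (a <= Num.max (h v - m) 0) = (a + m <= h v).
  by move=> a0; rewrite le_max (leNgt a 0) a0 orbF lerBrDr.
(* Strictness already comes from the layer of height [m] in [Hm]; the weak bound here also covers
   the case where [f'] vanishes. *)
have Hle : c%:R * \sum_v f' v <= \sum_v g' v.
  case: (pselect (exists v, f' v != 0)) => [ex|nex]; last first.
    rewrite big1 ?mulr0; first by apply: sumr_ge0 => v _; rewrite le_max lexx orbT.
    by move=> v _; apply/eqP/negPn/negP => fv; apply: nex; exists v.
  apply/ltW/IHd => //.
  - apply: leq_trans fd; apply: proper_card; apply/properP; split.
      apply/fintype.subsetP => v; rewrite !inE /f'; apply: contraNneq => ->.
      by rewrite max_r// sub0r oppr_le0 ltW.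
    by exists v1; rewrite !inE// /f' subrr maxxx eqxx.
  - by move=> v; rewrite le_max lexx orbT.
  - by move=> v; rewrite le_max lexx orbT.
  move=> a a0 [v av].
  rewrite (eq_card (B := [pred v | a + m <= f v])); last first.
    by move=> u; rewrite !inE shift.
  rewrite [ltnRHS](eq_card (B := [pred v | a + m <= g v])); last first.
    by move=> u; rewrite !inE shift.
  by apply: H; [exact: addr_gt0 | exists v; rewrite -shift].
rewrite sumf mulrDr; apply: lt_le_trans sumg.
exact: ltr_leD.
Qed.

(** Stated for the family of choices and not for their union: the edge must be chosen by a vertex of
    [A], so that failure at a given pair is an event about independent choices. *)
Definition expanding {T : finType} (r : nat) (E : T -> {set {set T}}) :=
  forall A B : {set T}, A != finset.set0 -> [disjoint A & B] ->
    (#|B| <= r.-1 * #|A|)%N ->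
    exists v e, [/\ v \in A, e \in E v & [disjoint e & B]].

(** Homogeneous condition, with [x] in the role of [w - 1/r] and no bounds on its values, so that it
    also serves as the dual condition in Farkas' lemma. *)
Definition rigid (R : realFieldType) {T : finType} (H : {set {set T}}) :=
  forall x : T -> R, (forall e, e \in H -> 0 <= \sum_(v in e) x v) ->
    \sum_v x v <= 0 -> forall v, x v = 0.

(** With [f] the negative part of [x] and [g] its positive part times r-1, the sum of [g] minus r-1
    times the sum of [f] is (r-1) x(V). The layer-cake bound would make this positive, so its
    hypothesis fails at some level [a], where expansion yields an edge of negative sum. *)
Lemma expanding_rigid {R : realFieldType} {T : finType} {r : nat}
    (E : {ffun T -> {set {set T}}}) :
  (forall v, E v \subset star (complete_hypergraph T r) v) ->
  expanding r E -> rigid R (kout_union E).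
Proof.
move=> Estar Eexp x xe xV.
pose f v := Num.max (- x v) 0; pose g v := Num.max (r.-1%:R * x v) 0.
have f0 v : 0 <= f v by rewrite le_max lexx orbT.
have g0 v : 0 <= g v by rewrite le_max lexx orbT.
case: (pselect (exists v, f v != 0)) => [ex|nex]; last first.
  have x0 v : 0 <= x v.
    rewrite leNgt; apply/negP => xv; apply: nex; exists v.
    by rewrite /f max_l ?oppr_ge0 ?ltW// oppr_eq0 lt_eqF.
  have : \sum_v x v = 0 by apply/le_anti; rewrite xV sumr_ge0.
  by move/eqP; rewrite psumr_eq0// => /allP xz v; apply/eqP/xz; rewrite mem_index_enum.
suff : r.-1%:R * \sum_v f v < \sum_v g v.
  have -> : \sum_v g v = r.-1%:R * \sum_v x v + r.-1%:R * \sum_v f v.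
    rewrite -mulrDr -big_split mulr_sumr; apply: eq_bigr => v _ /=.
    rewrite /f /g; case: (leP 0 (x v)) => xv.
      rewrite (max_l (x := _ * _)) ?mulr_ge0// (max_r (x := - _)) ?oppr_le0//.
      by rewrite addr0.
    rewrite (max_r (x := _ * _)) ?mulr_ge0_le0 ?(ltW xv)//.
    by rewrite (max_l (x := - _)) ?oppr_ge0 ?(ltW xv)// subrr mulr0.
  by rewrite ltrDr ltNge mulr_ge0_le0.
apply: layer_cake_lt => // a a0 [v0 av0].
rewrite ltnNge; apply/negP => card_le.
pose A := [set v | a <= f v]%SET; pose B := [set v | a <= g v]%SET.
have fE v : (a <= f v) = (a <= - x v) by rewrite /f le_max (leNgt a 0) a0 orbF.
have gE v : (a <= g v) = (a <= r.-1%:R * x v) by rewrite /g le_max (leNgt a 0) a0 orbF.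
have [|||v [e [vA ev eB]]] := Eexp A B.
- by apply/finset.set0Pn; exists v0; rewrite inE.
- apply/pred0P => v /=; apply/negP => /andP[]; rewrite !inE fE gE => av.
  apply/negP; rewrite -ltNge; apply: le_lt_trans (a0).
  by rewrite mulr_ge0_le0// -oppr_ge0 (le_trans (ltW a0)).
- by rewrite /A /B !cardsE.
have := fintype.subsetP (Estar v) _ ev; rewrite !inE => /andP[/eqP er ve].
have /xe : e \in kout_union E by apply/bigcupP; exists v.
apply/negP; rewrite -ltNge (bigD1 v)//=.
have r1 : #|[pred u | (u \in e) && (u != v)]| = r.-1.
  rewrite -er (cardD1 v e) ve /=; apply: eq_card => u.
  by rewrite !inE andbC.
have xu u : (u \in e) && (u != v) -> r.-1%:R * x u < a.
  move=> /andP[ue _]; have := disjointFr eB ue.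
  by rewrite inE gE => /negbT; rewrite -ltNge.
have xv : x v <= - a by move: vA; rewrite inE fE lerNr.
have ltx0 : - a < 0 by rewrite oppr_lt0.
(* If r = 1 the edge is [v] alone; otherwise the r-1 other vertices, each below a/(r-1), add up to
   less than [a]. *)
have [r0|r0] := posnP r.-1.
  have none u : (u \in e) && (u != v) = false.
    by move: r1; rewrite r0 => /card0_eq/(_ u).
  by rewrite (eq_bigl _ _ none) big_pred0// addr0 (le_lt_trans xv ltx0).
suff : r.-1%:R * \sum_(i in e | i != v) x i < r.-1%:R * a.
  rewrite ltr_pM2l ?ltr0n// => sum_lt; rewrite -[ltRHS](addNr a).
  exact: ler_ltD.
rewrite mulr_sumr -{2}r1 mulr_natl -sumr_const.
apply: ltr_sum => //.
have /card_gt0P[u ux] : (0 < #|[pred u | (u \in e) && (u != v)]|)%N by rewrite r1.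
by apply/hasP; exists u.
Qed.

(** * Farkas' lemma and the two consequences of rigidity *)

(* Bartl's proof: if the last vector [a i0] is needed, there is [y] with
   [a i0 . y = -1], [b . y < 0] and [a i . y >= 0] for the others; project along
   [y] onto the kernel of [a i0]. *)
Lemma farkas {R : realFieldType} {T : finType} {J : eqType} (s : seq J)
    (a : J -> T -> R) (b : T -> R) :
  uniq s ->
  (forall x : T -> R, (forall i, i \in s -> 0 <= \sum_v a i v * x v) ->
     0 <= \sum_v b v * x v) ->
  exists phi : J -> R, (forall i, 0 <= phi i) /\
    (forall v, \sum_(i <- s) phi i * a i v = b v).
Proof.
elim: s a b => [|i0 s IHs] a b /= => [_ H|/andP[i0s us] H].
  exists (fun=> 0); split=> // v; rewrite big_nil.
  (* Without vectors, testing [x = - b] forces [b = 0]. *)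
  have : 0 <= \sum_u b u * - b u by exact: H.
  have -> : \sum_u b u * - b u = - \sum_u b u ^+ 2.
    by rewrite -sumrN; apply: eq_bigr => u _; rewrite mulrN.
  rewrite oppr_ge0 => sum_le0.
  have : \sum_v b v ^+ 2 = 0.
    by apply/le_anti; rewrite sum_le0 sumr_ge0// => u _; exact: sqr_ge0.
  move/eqP; rewrite psumr_eq0; last by move=> u _; exact: sqr_ge0.
  by move=> /allP/(_ v (mem_index_enum v)) /=; rewrite sqrf_eq0 => /eqP.
pose dot (c d : T -> R) := \sum_v c v * d v.
have dotD c c' d t : dot (fun v => c v + t * c' v) d = dot c d + t * dot c' d.
  by rewrite /dot mulr_sumr -big_split; apply: eq_bigr => v _; rewrite mulrDl mulrA.
have dotDr c d d' t : dot c (fun v => d v + t * d' v) = dot c d + t * dot c d'.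
  by rewrite /dot mulr_sumr -big_split; apply: eq_bigr => v _; rewrite mulrDr mulrCA.
case: (pselect (forall x, (forall i, i \in s -> 0 <= dot (a i) x) -> 0 <= dot b x)).
  move=> /(IHs _ _ us)[phi [phi0 phib]].
  exists (fun i => if i == i0 then 0 else phi i); split=> [i|v].
    by case: ifP.
  rewrite big_cons eqxx mul0r add0r -phib; apply: eq_big_seq => i si.
  by case: eqP => // ii0; rewrite -ii0 si in i0s.
move=> /existsNP[y /not_implyP[ys /negP]]; rewrite -ltNge => by0.
have ay : dot (a i0) y < 0.
  rewrite ltNge; apply/negP => ay; move: by0; apply/negP; rewrite -leNgt.
  by apply: H => i; rewrite inE => /orP[/eqP->|/ys].
pose z v := - (dot (a i0) y)^-1 * y v.
have dotz c : dot c z = - (dot (a i0) y)^-1 * dot c y.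
  by rewrite /dot mulr_sumr; apply: eq_bigr => v _; rewrite mulrCA.
have t0 : 0 < - (dot (a i0) y)^-1 by rewrite oppr_gt0 invr_lt0.
have az : dot (a i0) z = -1 by rewrite dotz mulNr mulVf// lt_eqF.
have bz : dot b z < 0 by rewrite dotz pmulr_rlt0.
have sz i : i \in s -> 0 <= dot (a i) z.
  by move=> /ys ?; rewrite dotz mulr_ge0// ltW.
(* The projection [x'] of [x] along [z] lies in the kernel of [a i0]. Moved to the other side of the
   dot product, it turns a vector [c] into c + (c . z) a i0, hence the modified vectors. *)
have [x xs|phi [phi0 phib]] :=
    IHs (fun i v => a i v + dot (a i) z * a i0 v) (fun v => b v + dot b z * a i0 v) us.
  pose x' v := x v + dot (a i0) x * z v.
  have x'E c : dot c x' = dot (fun v => c v + dot c z * a i0 v) x.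
    by rewrite dotD dotDr mulrC.
  rewrite -[leRHS]/(dot _ _) -x'E; apply: H => i.
  rewrite inE => /orP[/eqP->|si]; last by rewrite -[leRHS]/(dot _ _) x'E xs.
  by rewrite -[leRHS]/(dot _ _) dotDr az mulrN1 subrr.
exists (fun i => if i == i0 then \sum_(j <- s) phi j * dot (a j) z - dot b z else phi i).
split=> [i|v].
  case: ifP => // _; rewrite addr_ge0 ?oppr_ge0 ?(ltW bz)//.
  by rewrite big_seq sumr_ge0// => j js; rewrite mulr_ge0// sz.
rewrite big_cons eqxx.
have -> : \sum_(j <- s) (if j == i0 then \sum_(j <- s) phi j * dot (a j) z - dot b z
    else phi j) * a j v = \sum_(j <- s) phi j * a j v.
  by apply: eq_big_seq => i si; case: eqP => // ii0; rewrite -ii0 si in i0s.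
have := phib v; under eq_bigr do rewrite mulrDr mulrA.
rewrite big_split -mulr_suml /= => /eqP; rewrite -subr_eq => /eqP <-.
by rewrite mulrBl; ring.
Qed.

Lemma sum_mem {R : pzSemiRingType} {T : finType} (e : {set T}) (x : T -> R) :
  \sum_v (v \in e)%:R * x v = \sum_(v in e) x v.
Proof.
by rewrite [RHS]big_mkcond; apply: eq_bigr => v _; case: ifP; rewrite ?mul1r ?mul0r.
Qed.

(** Farkas' lemma is applied to the incidence vectors of the edges and the all-ones vector: an [x]
    violating its hypothesis has negative total, yet rigidity makes it zero. The weights obtained
    sum to 1 at each vertex, and so are at most 1 because edges are nonempty. *)
Lemma rigid_perfect {R : realType} {T : finType} {r : nat} {H : {set {set T}}} :
  (0 < r)%N -> H \subset complete_hypergraph T r -> rigid R H ->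
  exists phi : {set T} -> R, perfect_fractional_matching r H phi.
Proof.
move=> r0 Hr Hrig.
have card_edge e : e \in H -> #|e| = r.
  by move=> /(fintype.subsetP Hr); rewrite inE => /eqP.
have [|x xe|phi [phi0 phi1]] :=
    @farkas R T _ (enum H) (fun e v => (v \in e)%:R) (fun=> 1).
- exact: enum_uniq.
- rewrite leNgt; apply/negP; under eq_bigr do rewrite mul1r.
  move=> x_lt0; have x0 : forall v, x v = 0.
    apply: Hrig (ltW x_lt0) => e eH.
    by rewrite -sum_mem; apply: xe; rewrite mem_enum.
  by rewrite big1 ?ltxx// in x_lt0.
have sum1 v : \sum_(e in H | v \in e) phi e = 1.
  rewrite -(phi1 v) big_enum /= [LHS]big_mkcondr.
  by apply: eq_bigr => e _; case: ifP; rewrite ?mulr1 ?mulr0.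
exists phi; split.
  split=> [e eH|v]; last by rewrite sum1.
  rewrite phi0 /=.
  have /card_gt0P[v ve] : (0 < #|e|)%N by rewrite card_edge.
  by rewrite -(sum1 v) (bigD1 e)/= ?eH// lerDl sumr_ge0.
apply: (mulIf (x := r%:R)); first by rewrite pnatr_eq0 -lt0n.
rewrite divfK ?pnatr_eq0 -?lt0n// /matching_weight.
(* Double counting of incidences: each edge is counted r times. *)
transitivity (\sum_(e in H) \sum_(v in e) phi e).
  rewrite mulr_suml; apply: eq_bigr => e eH.
  by rewrite sumr_const (card_edge _ eH) mulr_natr.
rewrite (exchange_big_dep xpredT)//= (eq_bigr (fun=> 1)) ?sumr_const//.
Qed.

(** As edges have r vertices, [w - 1/r] has nonnegative sum on each edge; its total is 0, so
    rigidity makes it vanish. *)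
Lemma rigid_cover {R : realType} {T : finType} {r : nat} {H : {set {set T}}}
    (w : T -> R) :
  (0 < r)%N -> H \subset complete_hypergraph T r -> rigid R H ->
  (fractional_cover H w /\ cover_weight w = #|T|%:R / r%:R) <->
    (forall v, w v = r%:R^-1).
Proof.
move=> r0 Hr Hrig.
have rn0 : r%:R != 0 :> R by rewrite pnatr_eq0 -lt0n.
have card_edge e : e \in H -> #|e| = r.
  by move=> /(fintype.subsetP Hr); rewrite inE => /eqP.
split=> [[[w01 we] wV] v|wE]; last first.
  rewrite /cover_weight (eq_bigr _ (fun v _ => wE v)) sumr_const mulr_natl.
  split=> //; split=> [v|e eH].
    by rewrite wE invr_ge0 ler0n invf_le1 ?ltr0n// ler1n r0.
  by rewrite (eq_bigr _ (fun v _ => wE v)) sumr_const card_edge// -[leRHS]mulr_natr mulVf.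
apply/eqP; rewrite -subr_eq0; apply/eqP.
apply: (Hrig (fun v => w v - r%:R^-1)) => [e eH|].
  rewrite sumrB sumr_const card_edge// -[_ *+ _]mulr_natr mulVf// subr_ge0.
  exact: we.
rewrite sumrB sumr_const.
by rewrite -/(cover_weight w) wV -[_^-1 *+ _]mulr_natl subrr.
Qed.

(** * Binomial estimates and the count of edges avoiding a set *)

(** Factor by factor, (m-i)/(n-i) is at most m/n: drawing without replacement hits an m-subset [k]
    times no more likely than drawing with replacement. *)
Lemma leq_bin_expn (m n k : nat) : (m <= n)%N -> ('C(m, k) * n ^ k <= 'C(n, k) * m ^ k)%N.
Proof.
move=> le_mn; rewrite -(leq_pmul2r (fact_gt0 k)) mulnAC bin_ffact mulnAC bin_ffact.
elim: k => // k IHk; rewrite !ffactnSr !expnS.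
have -> : (m ^_ k * (m - k) * (n * n ^ k) = m ^_ k * n ^ k * ((m - k) * n))%N by ring.
have -> : (n ^_ k * (n - k) * (m * m ^ k) = n ^_ k * m ^ k * ((n - k) * m))%N by ring.
by apply: leq_mul => //; rewrite !mulnBl mulnC leq_sub2l// leq_mul2l le_mn orbT.
Qed.

Lemma leq_bin_ratio (c m n k : nat) :
  (forall i, (i < k)%N -> (n - i <= c * (m - i))%N) ->
  ('C(n, k) <= c ^ k * 'C(m, k))%N.
Proof.
move=> H; rewrite -(leq_pmul2r (fact_gt0 k)) -mulnA !bin_ffact.
elim: k H => // k IHk H; rewrite !ffactnSr expnS.
have -> : (c * c ^ k * (m ^_ k * (m - k)) = c ^ k * m ^_ k * (c * (m - k)))%N by ring.
by apply: leq_mul; [apply: IHk => i ik; apply: H; exact: ltnW | exact: H].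
Qed.

(** Cross-multiplied form of a union bound: a random j-subset of m points meets a given b-subset
    with probability at most jb/m. By Pascal's rule each removed point costs at most C(m-1, j-1)
    subsets. *)
Lemma leq_bin_sub (m b j : nat) :
  (m * ('C(m, j) - 'C(m - b, j)) <= j * b * 'C(m, j))%N.
Proof.
case: j => [|j]; first by rewrite !bin0 subnn muln0.
rewrite mulnAC -mul_bin_diag -mulnA leq_mul2l; apply/orP; right.
rewrite leq_subLR.
elim: b => [|b IHb]; first by rewrite subn0 muln0 addn0.
apply: leq_trans IHb _; rewrite mulnS addnA leq_add2r.
case: (posnP (m - b)) => [mb|]; first by rewrite subnS mb leq_addr.
rewrite subnS; case E: (m - b)%N => [//|d] _.
by rewrite binS leq_add2l leq_bin2l//=; lia.
Qed.

(** Deleting [v] maps these edges bijectively onto the r-subsets of the complement of [v |: B]. *)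
Lemma card_star_disjoint {T : finType} {v : T} {B : {set T}} (r : nat) : v \notin B ->
  #|[set e in star (complete_hypergraph T r.+1) v | [disjoint e & B]]%SET| =
  'C(#|T|.-1 - #|B|, r).
Proof.
move=> vB.
have -> : (#|T|.-1 - #|B| = #|~: (v |: B)|)%N.
  by have := cardsC (v |: B); rewrite cardsU1 vB /=; lia.
rewrite -cards_draws -(card_in_imset (f := fun e => v |: e)) => [|e e']; last first.
  rewrite !inE => /andP[/fintype.subsetP ev _] /andP[/fintype.subsetP e'v _].
  have nv (f : {set T}) : (forall x, x \in f -> x \in ~: (v |: B)) -> v \notin f.
    by move=> H; apply/negP => /H; rewrite !inE eqxx.
  by move=> /(congr1 (fun f => f :\ v)%SET); rewrite !finset.setU1K ?nv.
congr #|pred_of_set _|; apply/setP => e; rewrite !inE; apply/idP/imsetP.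
  move=> /andP[/andP[/eqP er ve] eB]; exists (e :\ v); last by rewrite finset.setD1K.
  rewrite !inE; apply/andP; split.
    apply/fintype.subsetP => u; rewrite !inE => /andP[uv ue].
    by rewrite negb_or uv (disjointFr eB ue).
  by move: er; rewrite (cardsD1 v) ve add1n => -[->].
move=> [f]; rewrite !inE => /andP[/fintype.subsetP fv /eqP fr] ->.
have vf : v \notin f by apply/negP => /fv; rewrite !inE eqxx.
rewrite cardsU1 vf fr !inE add1n !eqxx /=.
apply/pred0P => u /=; apply/negP => /andP[]; rewrite !inE => /orP[/eqP->|/fv].
  by rewrite (negbTE vB).
by rewrite !inE negb_or => /andP[_ /negbTE ->].
Qed.

(** * Union bound in the k-out model *)

Lemma uniform_pmf_ge0 {R : realType} {X : finType} (A : {set X}) (x : X) :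
  0 <= uniform_pmf R A x.
Proof. by rewrite /uniform_pmf; case: ifP => // _; rewrite invr_ge0 ler0n. Qed.

Lemma kout_choices_sub {T : finType} {k : nat} {H : {set {set T}}} {v : T}
    {S : {set {set T}}} : S \in kout_choices k H v -> S \subset star H v.
Proof.
rewrite /kout_choices; case: ifP => _; rewrite inE; first by move/eqP->.
by case/andP.
Qed.

(** The exact value is a ratio of binomials, bounded by [leq_bin_expn]. If the star has fewer than
    [k] edges, the choice is the whole star, which a proper subset [M] cannot contain, and the sum
    is 0. *)
Lemma kout_sub_prob {R : realType} {T : finType} (k : nat) (H : {set {set T}})
    (v : T) (M : {set {set T}}) : M \proper star H v ->
  \sum_(S : {set {set T}} | S \subset M) uniform_pmf R (kout_choices k H v) S <=
  (#|M|%:R / #|star H v|%:R) ^+ k.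
Proof.
move=> MH; have [sMH ltMH] := (proper_sub MH, proper_card MH).
have N0 : 0 < #|star H v|%:R :> R by rewrite ltr0n (leq_trans _ ltMH).
rewrite /uniform_pmf /kout_choices; case: ltnP => [ltk|lek].
  rewrite big1 ?exprn_ge0 ?divr_ge0// => S SM; rewrite inE; case: eqP => // SH.
  by move: MH; rewrite properE -SH SM andbF.
set D := [set _ | _ & _]%SET.
have -> : \sum_(S : {set {set T}} | S \subset M) (if S \in D then #|D|%:R^-1 else 0)
    = 'C(#|M|, k)%:R / 'C(#|star H v|, k)%:R :> R.
  rewrite -big_mkcondr /= /D cards_draws sumr_const -[LHS]mulr_natl; congr (_%:R * _).
  rewrite -(cards_draws M k); apply: eq_card => S; rewrite !inE -!topredE /= !inE.
  by case SM: (S \subset M) => //=; rewrite (fintype.subset_trans SM sMH).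
rewrite expr_div_n ler_pdivrMr ?ltr0n ?bin_gt0// mulrAC ler_pdivlMr ?exprn_gt0//.
by rewrite -!natrX -!natrM ler_nat [leqRHS]mulnC leq_bin_expn// ltnW.
Qed.

Definition touching {T : finType} (r : nat) (B : {set T}) (v : T) : {set {set T}} :=
  [set e in star (complete_hypergraph T r) v | ~~ [disjoint e & B]]%SET.

(** The deterministic part of a failure of [expanding]; the random part is the event [hit] that all
    edges chosen in [p.1] touch [p.2]. *)
Definition obstruction {T : finType} (r : nat) (p : {set T} * {set T}) : bool :=
  [&& p.1 != finset.set0, [disjoint p.1 & p.2] & (#|p.2| <= r.-1 * #|p.1|)%N].

(** When [Q] fails on a family of nonzero mass, that family hits some obstruction. The failure
    probability is thus at most the expected number of obstructions hit, and independence turns the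
    probability of each hit into a product over [p.1]. *)
Lemma kout_prob_ge {R : realType} {T : finType} {r k : nat}
    (Q : {set {set T}} -> Prop) :
  (forall E : {ffun T -> {set {set T}}},
     (forall v, E v \subset star (complete_hypergraph T r) v) ->
     expanding r E -> Q (kout_union E)) ->
  (forall p v, obstruction r p -> v \in p.1 ->
     touching r p.2 v \proper star (complete_hypergraph T r) v) ->
  1 - \sum_(p | obstruction r p) \prod_(v in p.1)
        (#|touching r p.2 v|%:R / #|star (complete_hypergraph T r) v|%:R) ^+ k
    <= kout_prob R k (complete_hypergraph T r) Q.
Proof.
move=> HQ Hproper; set H := complete_hypergraph T r.
pose mu (E : {ffun T -> {set {set T}}}) : R :=
  \prod_v uniform_pmf R (kout_choices k H v) (E v).
have mu0 E : 0 <= mu E by apply: prodr_ge0 => v _; exact: uniform_pmf_ge0.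
have muT : \sum_E mu E = 1.
  rewrite -(kout_prob_total R k H) /kout_prob; apply: eq_bigl => E.
  by apply/esym/asboolP.
pose hit (E : {ffun T -> {set {set T}}}) (p : {set T} * {set T}) :=
  [forall v, (v \in p.1) ==> (E v \subset touching r p.2 v)].
rewrite -{1}muT (bigID (fun E => `[< Q (kout_union E) >])) /= lerBlDr lerD2l.
apply: (@le_trans _ _ (\sum_E \sum_(p | obstruction r p) (hit E p)%:R * mu E)).
  rewrite [leLHS]big_mkcond; apply: ler_sum => E _; case: ifP => [QE|_]; last first.
    by apply: sumr_ge0 => p _; rewrite mulr_ge0.
  have [->|muE] := eqVneq (mu E) 0; first by apply: sumr_ge0 => p _; rewrite mulr0.
  have Estar v : E v \subset star H v.
    apply: (@kout_choices_sub _ k); apply/negPn/negP => Ev; move/eqP: muE; apply.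
    by rewrite /mu (bigD1 v)//= /uniform_pmf (negbTE Ev) mul0r.
  case: (pselect (exists2 p, obstruction r p & hit E p)) => [[p op hp]|nex].
    rewrite (bigD1 p)//= hp mul1r lerDl sumr_ge0// => p' _.
    by rewrite mulr_ge0.
  case/negP: QE; apply/asboolP; apply: HQ => // A B A0 AB cardB.
  apply: contrapT => nve; apply: nex; exists (A, B); first exact/and3P.
  apply/forallP => v; apply/implyP => vA; apply/fintype.subsetP => e ev.
  rewrite inE (fintype.subsetP (Estar v) _ ev) /=; apply/negP => eB.
  by apply: nve; exists v, e.
rewrite exchange_big /=; apply: ler_sum => p op.
(* The indicator of a hit is distributed over the vertices, so that the sum over families factors; a
   vertex outside [p.1] contributes 1. *)
pose F (v : T) (S : {set {set T}}) : R := ((v \in p.1) ==> (S \subset touching r p.2 v))%:R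
  * uniform_pmf R (kout_choices k H v) S.
have -> : \sum_E (hit E p)%:R * mu E = \sum_(E : {ffun T -> {set {set T}}}) \prod_v F v (E v).
  apply: eq_bigr => E _; rewrite big_split /=; congr (_ * _).
  have [/forallP hE|/forallPn[v hv]] := boolP (hit E p).
    by rewrite big1// => v _; rewrite hE.
  by rewrite (bigD1 v)//= (negbTE hv) mul0r.
rewrite -(bigA_distr_bigA F) /= [leRHS]big_mkcond /=.
apply: ler_prod => v _; apply/andP; split.
  by apply: sumr_ge0 => S _; rewrite mulr_ge0 ?uniform_pmf_ge0.
rewrite /F; case: ifP => vp /=.
  apply: le_trans (kout_sub_prob k _ _ _ (Hproper _ _ op vp)).
  by rewrite [leRHS]big_mkcond; apply: ler_sum => S _; case: ifP; rewrite ?mul1r ?mul0r.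
under eq_bigr do rewrite mul1r.
rewrite /uniform_pmf -big_mkcond /= sumr_const -[leLHS]mulr_natl.
by rewrite divff // pnatr_eq0 -lt0n kout_choices_gt0.
Qed.

(** * Probability that a random edge at a vertex of A meets B *)

Lemma card_star {T : finType} (r : nat) (v : T) :
  #|star (complete_hypergraph T r.+1) v| = 'C(#|T|.-1, r).
Proof.
have := @card_star_disjoint _ v finset.set0 r; rewrite inE => /(_ isT).
rewrite cards0 subn0 => <-; apply: eq_card => e; rewrite !inE.
by rewrite disjoint_sym finset.disjoints_subset finset.sub0set andbT.
Qed.

Lemma card_touching {T : finType} (r : nat) {v : T} {B : {set T}} : v \notin B ->
  #|touching r.+1 B v| = ('C(#|T|.-1, r) - 'C(#|T|.-1 - #|B|, r))%N.
Proof.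
move=> vB; rewrite -(card_star r v) -(card_star_disjoint r vB).
set D := [set e in _ | _]%SET.
rewrite -(cardsID D (star _ v)) (finset.setIidPr _).
  rewrite addKn; apply: eq_card => e; rewrite !inE.
  by case: (_ && (v \in e)); rewrite ?andbF ?andbT.
by apply/fintype.subsetP => e; rewrite !inE => /andP[].
Qed.

(** Let d = n - b with b = |B|. Since |A| <= d and b <= r|A|, n is at most (r+1)d, hence d >=
    2(r+1), and each factor n-1-i is at most 2(r+1) times d-1-i. *)
Lemma obstruction_bin {T : finType} {r : nat} {p : {set T} * {set T}} :
  (2 * r.+1 ^ 2 <= #|T|)%N -> obstruction r.+1 p ->
  ('C(#|T|.-1, r) <= (2 * r.+1) ^ r * 'C(#|T|.-1 - #|p.2|, r))%N.
Proof.
case: p => A B Tr /and3P[/= _ AB cB]; apply: leq_bin_ratio => i ir.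
have cAB : (#|A| + #|B| <= #|T|)%N.
  by rewrite -cardsUI (disjoint_setI0 AB) cards0 addn0 max_card.
move: Tr cB cAB; move: #|A| #|B| #|T| => a b n Tr cB cAB.
have [d dE] : exists d, n = (b + d)%N by exists (n - b)%N; lia.
have bd : (b <= r * d)%N by apply: leq_trans cB _; rewrite leq_mul2l; lia.
have d2 : (2 * r.+1 <= d)%N.
  rewrite -(leq_pmul2l (ltn0Sn r)); apply: leq_trans (_ : n <= _)%N; last by lia.
  by apply: leq_trans Tr; lia.
suff : ((r.+1 * d).-1 <= 2 * r.+1 * (d - r))%N by nia.
nia.
Qed.

Section Ratio.
Context {R : realType} {T : finType} {r : nat} {p : {set T} * {set T}} {v : T}.
Context (Tr : (2 * r.+1 ^ 2 <= #|T|)%N) (op : obstruction r.+1 p) (vp : v \in p.1).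

Let vB : v \notin p.2.
Proof. by case/and3P: op => _ AB _; rewrite (disjointFr AB vp). Qed.

Let N0 : (0 < 'C(#|T|.-1, r))%N.
Proof. by rewrite bin_gt0; nia. Qed.

Let D0 : (0 < 'C(#|T|.-1 - #|p.2|, r))%N.
Proof. by have := leq_trans N0 (obstruction_bin Tr op); rewrite muln_gt0 => /andP[]. Qed.

Lemma touching_proper :
  touching r.+1 p.2 v \proper star (complete_hypergraph T r.+1) v.
Proof.
rewrite properEcard card_star card_touching//; apply/andP; split.
  by apply/fintype.subsetP => e; rewrite inE => /andP[].
by rewrite ltn_subrL N0 D0.
Qed.

Lemma touching_ratio_lt1 :
  #|touching r.+1 p.2 v|%:R / #|star (complete_hypergraph T r.+1) v|%:R <=
  1 - ((2 * r.+1) ^ r)%:R^-1 :> R.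
Proof.
rewrite card_star card_touching// ler_pdivrMr ?ltr0n//.
rewrite natrB ?leq_bin2l ?leq_subr// mulrBl mul1r lerD2l lerN2.
rewrite mulrC ler_pdivrMr ?ltr0n ?expn_gt0// -natrM ler_nat mulnC.
exact: obstruction_bin.
Qed.

(** By [leq_bin_sub] the ratio is at most r|B|/(n-1), with |B| <= r|A|; the factor 2 pays for
    replacing n-1 by n. *)
Lemma touching_ratio_small :
  #|touching r.+1 p.2 v|%:R / #|star (complete_hypergraph T r.+1) v|%:R <=
  (2 * r ^ 2)%:R * (#|p.1|%:R / #|T|%:R) :> R.
Proof.
have n0 : (1 < #|T|)%N by nia.
rewrite card_star card_touching// mulrA ler_pdivrMr ?ltr0n//.
rewrite mulrAC ler_pdivlMr ?ltr0n; last exact: ltnW.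
rewrite -!natrM ler_nat.
case/and3P: op => _ _ cB.
have := leq_bin_sub #|T|.-1 #|p.2| r.
move: N0 D0; set N := 'C(_, _); set M := (N - _)%N => _ _ H.
apply: (@leq_trans (2 * (#|T|.-1 * M))%N); first by nia.
apply: leq_trans (_ : 2 * (r * (r * #|p.1|) * N) <= _)%N; last by nia.
rewrite leq_mul2l /=; apply: leq_trans H _.
by rewrite leq_mul2r leq_mul2l cB !orbT.
Qed.

End Ratio.

(** * Summation over all obstructions *)

(* Markov's inequality for the sum of x ^ |B| over all sets B. *)
Lemma card_small_sets {R : realType} (T : finType) (t : nat) (x : R) :
  0 <= x <= 1 -> #|[set B : {set T} | (#|B| <= t)%N]%SET|%:R * x ^+ t <= (1 + x) ^+ #|T|.
Proof.
move=> /andP[x0 x1]; rewrite -prodr_const addrC.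
rewrite (bigA_distr _ _ (fun=> x) (fun=> 1)) /= mulr_natl -sumr_const.
rewrite big_mkcond; apply: ler_sum => B _; rewrite inE.
rewrite -big_mkcond /= prodr_const.
case: ifP => [Bt|_]; first by rewrite ler_wiXn2l.
exact: exprn_ge0.
Qed.

Lemma exp_1D_le {R : realType} (n s : nat) :
  (1 + s%:R / n%:R) ^+ n <= expR 1 ^+ s :> R.
Proof.
case: n => [|n]; first by rewrite expr0 exprn_ege1// -[leLHS]expR0 ler_expR.
rewrite -!expRM_natl mulr1.
apply: le_trans (_ : expR (s%:R / n.+1%:R) ^+ n.+1 <= _).
  by rewrite lerXn2r ?nnegrE ?expR_ge0 ?expR_ge1Dx// addr_ge0// divr_ge0.
by rewrite -expRM_natl mulrC divfK ?pnatr_eq0.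
Qed.

Lemma sum_geometric_half {R : realType} (n : nat) :
  \sum_(s < n) (2^-1 : R) ^+ s.+1 <= 1.
Proof.
suff -> : \sum_(s < n) (2^-1 : R) ^+ s.+1 = 1 - 2^-1 ^+ n by rewrite gerBl exprn_ge0// invr_ge0.
elim: n => [|n IHn]; first by rewrite big_ord0 expr0 subrr.
by rewrite big_ord_recr /= IHn !exprS; field.
Qed.

(** With s = |A| and x = s/n, the exponent (r+2)s splits into rs to pay for the sets B, s to pay for
    the sets A, and s left over for the decay in n. *)
Lemma obstruction_sum {R : realType} (T : finType) (r : nat) :
  \sum_(p : {set T} * {set T} | obstruction r.+1 p)
     (#|p.1|%:R / (4 * expR 1 ^+ 2 * #|T|%:R)) ^+ (r.+2 * #|p.1|) <= #|T|%:R^-1 :> R.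
Proof.
set L := 4 * expR 1 ^+ 2; set n := #|T|.
have E1 : 1 <= expR 1 :> R by rewrite -[leLHS]expR0 ler_expR.
have L1 : 1 <= L by rewrite /L; have := exprn_ege1 2 E1; lra.
pose G s : R := (s%:R / (L * n%:R)) ^+ (r.+2 * s).
have G0 s : 0 <= G s by rewrite exprn_ge0// divr_ge0// mulr_ge0//; lra.
pose small t := [set B : {set T} | (#|B| <= t)%N]%SET.
(* Obstructions are grouped by |A| = s+1, then the range is enlarged to all sets within the size
   bounds, which [card_small_sets] counts. *)
apply: (@le_trans _ _ (\sum_(s < n) \sum_(A in small s.+1) \sum_(B in small (r * s.+1)%N) G s.+1)).
  under [leRHS]eq_bigr do rewrite pair_big /=.
  rewrite (exchange_big_dep xpredT)//= big_mkcond; apply: ler_sum => -[A B] _.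
  case: ifP => [/and3P[/= A0 AB cB]|_]; last by apply: sumr_ge0.
  have [s As] : {s : 'I_n | #|A| = s.+1}.
    have sn : (#|A|.-1 < n)%N.
      by have := max_card A; move: A0; rewrite -card_gt0 -/n; lia.
    by exists (Ordinal sn) => /=; rewrite prednK// card_gt0.
  rewrite (bigD1 s)/= ?inE ?As ?leqnn -?As ?cB// -/(G _) lerDl.
  by apply: sumr_ge0.
have [n0|n0] := posnP n; first by rewrite big1 ?invr_ge0 ?ler0n// => -[s]; rewrite n0.
apply: (@le_trans _ _ (\sum_(s < n) n%:R^-1 * 2^-1 ^+ s.+1)); last first.
  by rewrite -mulr_sumr ler_piMr ?invr_ge0// sum_geometric_half.
apply: ler_sum => s _; rewrite !sumr_const -mulrnA -[leLHS]mulr_natl natrM.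
move: (s.+1) (ltn_ord s) (ltn0Sn s) => {}s sn s0.
(* There are at most x^(-s) e^s sets A and x^(-rs) e^s sets B, and L = 4 e^2. *)
set x : R := s%:R / n%:R.
have x01 : 0 <= x <= 1.
  by rewrite divr_ge0//= ler_pdivrMr ?ltr0n// mul1r ler_nat.
have -> : G s = x ^+ (r * s) * x ^+ s * (x ^+ s / L ^+ (r.+2 * s)).
  rewrite /G invfM mulrCA mulrC -/x expr_div_n.
  by rewrite mulrA -!exprD; congr (x ^+ _ / _); lia.
set c1 := #|_|%:R; set c2 := #|_|%:R.
have -> : c1 * c2 * (x ^+ (r * s) * x ^+ s * (x ^+ s / L ^+ (r.+2 * s))) =
    (c1 * x ^+ (r * s)) * (c2 * x ^+ s) * (x ^+ s / L ^+ (r.+2 * s)) by ring.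
have Lp k : 0 < L ^+ k by rewrite exprn_gt0// (lt_le_trans ltr01).
apply: (@le_trans _ _ (expR 1 ^+ s * expR 1 ^+ s * (x ^+ s / L ^+ (r.+2 * s)))).
  case/andP: (x01) => x0 _.
  rewrite ler_wpM2r ?divr_ge0 ?(ltW (Lp _)) ?exprn_ge0//.
  apply: ler_pM; rewrite ?mulr_ge0 ?exprn_ge0 ?ler0n//.
    exact: le_trans (card_small_sets _ _ _ x01) (exp_1D_le _ _).
  exact: le_trans (card_small_sets _ _ _ x01) (exp_1D_le _ _).
apply: (@le_trans _ _ (expR 1 ^+ s * expR 1 ^+ s * (x ^+ s / L ^+ s))).
  case/andP: (x01) => x0 _.
  rewrite ler_wpM2l ?mulr_ge0 ?exprn_ge0 ?expR_ge0// ler_wpM2l ?exprn_ge0//.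
  by rewrite lef_pV2 ?posrE// ler_weXn2l// leq_pmull.
rewrite -exprMn -expr_div_n -exprMn.
have -> : expR 1 * expR 1 * (x / L) = x / 4.
  by rewrite /L; field; rewrite gt_eqF ?expR_gt0.
rewrite expr_div_n.
(* One factor x supplies 1/n; the remaining s/4^s is at most 2^(-s), since s < 2^s. *)
have xs : x ^+ s <= x by case/andP: x01 => x0 x1; rewrite -[leRHS]expr1 ler_wiXn2l.
apply: le_trans (_ : x / 4 ^+ s <= _); first by rewrite ler_wpM2r ?invr_ge0 ?exprn_ge0.
have -> : (4 : R) = 2 * 2 by ring.
rewrite exprMn invfM exprVn /x mulrA [_ * n%:R^-1]mulrC -!mulrA ler_wpM2l ?invr_ge0//.
rewrite mulrA ler_piMl ?invr_ge0 ?exprn_ge0// ler_pdivrMr ?exprn_gt0// mul1r.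
by rewrite -natrX ler_nat ltnW// ltn_expl.
Qed.

(** * Choice of k and passage to the limit *)

Lemma kout_prob_le1 {R : realType} {T : finType} (k : nat) (H : {set {set T}})
    (Q : {set {set T}} -> Prop) : kout_prob R k H Q <= 1.
Proof.
rewrite -(kout_prob_total R k H) /kout_prob [leRHS](eq_bigl xpredT); last first.
  by move=> E; exact/asboolP.
rewrite big_mkcond; apply: ler_sum => E _; case: ifP => // _.
by apply: prodr_ge0 => v _; exact: uniform_pmf_ge0.
Qed.

Lemma kout_expanding_prob {R : realType} (r : nat) :
  exists2 k : nat, (0 < k)%N & forall (T : finType) (Q : {set {set T}} -> Prop),
    (2 * r.+1 ^ 2 <= #|T|)%N ->
    (forall E : {ffun T -> {set {set T}}},
       (forall v, E v \subset star (complete_hypergraph T r.+1) v) ->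
       expanding r.+1 E -> Q (kout_union E)) ->
    1 - #|T|%:R^-1 <= kout_prob R k (complete_hypergraph T r.+1) Q.
Proof.
set L : R := 4 * expR 1 ^+ 2; set C : R := (2 * r ^ 2)%:R.
have L0 : 0 < L by rewrite mulr_gt0// exprn_gt0// expR_gt0.
have C0 : 0 <= C by rewrite ler0n.
(* With q the probability that an edge meets B and x = |A| / n, [q <= c] and
   [q <= C x] give [q ^ (m+1) <= C x c ^ m <= x / L]. *)
set c : R := 1 - ((2 * r.+1) ^ r)%:R^-1.
have K1 : (1 : R) <= ((2 * r.+1) ^ r)%:R by rewrite ler1n expn_gt0.
have c0 : 0 <= c by rewrite subr_ge0 invf_le1// (lt_le_trans ltr01).
have c1 : c < 1 by rewrite ltrBlDr ltrDl invr_gt0 (lt_le_trans ltr01).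
(* The added 1 keeps the factor positive when [C = 0], that is, for edges of size 1. *)
have [m cm] : exists m, c ^+ m * (C * L + 1) <= 1.
  have CL : 0 < C * L + 1 by rewrite ltr_wpDl// mulr_ge0// ltW.
  have /cvgrPdist_lt cv : ((GRing.exp c : nat -> R) @ \oo --> (0 : R))%classic.
    by apply: cvg_expr; rewrite ger0_norm.
  have [|m _ /(_ m (leqnn m))/=] := cv (C * L + 1)^-1; first by rewrite invr_gt0.
  rewrite sub0r normrN ger0_norm ?exprn_ge0// => /ltW cm.
  by exists m; rewrite -ler_pdivlMr// mul1r.
(* The m+1 powers bring the ratio below x/L; raising to the power r+2 then matches the summand of
   [obstruction_sum]. *)
exists (m.+1 * r.+2)%N => // T Q Tr HQ.
apply: le_trans (kout_prob_ge _ HQ _); last first.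
  by move=> p v op vp; exact: touching_proper.
rewrite lerD2l lerN2; apply: le_trans (obstruction_sum T r).
apply: ler_sum => p op; rewrite [leRHS]exprM -prodr_const.
apply: ler_prod => v vp; rewrite exprn_ge0 ?divr_ge0//=.
rewrite exprM lerXn2r ?nnegrE ?divr_ge0 ?mulr_ge0 ?exprn_ge0 ?divr_ge0 ?expR_ge0//.
have q1 := touching_ratio_lt1 (R := R) Tr op vp.
have q2 := touching_ratio_small (R := R) Tr op vp.
set q := _ / _ in q1 q2 *.
have q0 : 0 <= q by rewrite divr_ge0.
rewrite -/L -/q exprS invfM mulrCA.
set x := #|_|%:R / #|_|%:R in q2 *.
have x0 : 0 <= x by rewrite divr_ge0.
apply: (@le_trans _ _ (C * x * c ^+ m)).
  by apply: ler_pM; rewrite ?exprn_ge0// lerXn2r ?nnegrE.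
rewrite mulrAC ler_wpM2r// -[leRHS]mul1r ler_pdivlMr//.
apply: le_trans cm; rewrite mulrDr mulr1 -mulrA mulrCA lerDl.
exact: exprn_ge0.
Qed.

Local Open Scope classical_set_scope.

Theorem theorem1 (R : realType) (r : nat) (hr : (0 < r)%N) :
  exists k : nat, (0 < k)%N /\
    (fun n : nat =>
       kout_prob R k (complete_hypergraph 'I_n r) (fun H =>
         (exists phi : {set 'I_n} -> R, perfect_fractional_matching r H phi) /\
         (forall w : 'I_n -> R,
            (fractional_cover H w /\ cover_weight w = n%:R / r%:R) <->
            (forall v, w v = r%:R^-1))))
      @ \oo --> (1 : R).
Proof.
case: r hr => // r hr; have [k k0 Hk] := @kout_expanding_prob R r.
exists k; split=> //.
have lim : (fun n : nat => 1 - (n%:R : R)^-1) @ \oo --> (1 - 0 : R).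
  (* The harmonic sequence is 1/(n+1), hence the shift. *)
  rewrite -(cvg_shiftS _).
  by apply: cvgB; [exact: cvg_cst | exact: cvg_harmonic].
rewrite subr0 in lim.
apply: squeeze_cvgr lim (cvg_cst (1 : R)).
exists (2 * r.+1 ^ 2)%N => // n /= le_n; rewrite kout_prob_le1 andbT.
have := Hk 'I_n; rewrite card_ord; apply=> // E Estar Eexp.
have Erig := expanding_rigid (R := R) E Estar Eexp.
have EH : kout_union E \subset complete_hypergraph 'I_n r.+1.
  apply/bigcupsP => v _; apply: fintype.subset_trans (Estar v) _.
  by apply/fintype.subsetP => e; rewrite inE => /andP[].
split; first exact: rigid_perfect.
by move=> w; rewrite -[n in n%:R]card_ord; exact: rigid_cover.
Qed.
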